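(* Let $n\ge 1$ be an integer, let $\mathrm{PF}_n$ be the set of parking functions of length $n$, and for $\pi\in \mathrm{PF}_n$ let $\mathrm{fix}(\pi)$ be the number of fixed points of $\pi$. Then, as polynomials in the indeterminate $q$, $$\sum_{\pi\in \mathrm{PF}_n} q^{\mathrm{fix}(\pi)}=\frac{1}{(n+1)^2} \left((q+n)^{n+1}-(q-1)^{n+1}\right).$$
   Context: A parking function of length $n$ is a sequence $\pi=(\pi_1,\dots,\pi_n)$ of positive integers such that, if $\lambda_1\le\cdots\le\lambda_n$ is the weakly increasing rearrangement of $\pi_1,\dots,\pi_n$, then $\lambda_i\le i$ for all $1\le i\le n$. An index $i\in\{1,\dots,n\}$ is a fixed point of $\pi$ if $\pi_i=i$. *)

(* Defs.v *)
From mathcomp Require Import all_boot.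
Set Implicit Arguments.
Unset Strict Implicit.
Unset Printing Implicit Defensive.

(* Positions are 0-based in 'I_n, so the mathematical index is i.+1; the
   entries of a sequence are the mathematical (positive) integers. *)
Definition is_parking (n : nat) (s : n.-tuple nat) : bool :=
  [forall i : 'I_n, 0 < tnth s i] &&
  [forall i : 'I_n, tnth [tuple of sort leq s] i <= i.+1].

Definition num_fixed (n : nat) (s : n.-tuple nat) : nat :=
  #|[set i : 'I_n | tnth s i == i.+1]|.

Definition nat_tuple (n : nat) (t : n.-tuple 'I_n.+1) : n.-tuple nat :=
  map_tuple val t.

(* Entries are taken in 'I_n.+1 = {0, ..., n} to get a finite type; no parking
   function is lost, as the last inequality forces all entries to be at most
   n (see PF_complete). *)
Definition PF (n : nat) : {set n.-tuple 'I_n.+1} :=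
  [set t | is_parking (nat_tuple t)].

Lemma nat_tuple_inj n : injective (@nat_tuple n).
Proof.
move=> t u /(congr1 val) /= /(inj_map val_inj) tu; exact: val_inj.
Qed.

Lemma PF_complete n (s : n.-tuple nat) :
  is_parking s <-> exists2 t, t \in PF n & nat_tuple t = s.
Proof.
split=> [ps | [t]]; last by rewrite inE => pt <-.
have le_s x : x \in val s -> x <= n.
  rewrite -(mem_sort leq) => /(nthP 0)[j]; rewrite size_sort size_tuple => jn <-.
  have /andP[_ /forallP/(_ (Ordinal jn))] := ps.
  by rewrite (tnth_nth 0) /= => /leq_trans; apply.
have E : nat_tuple (map_tuple (fun x => inord x : 'I_n.+1) s) = s.
  apply: val_inj; rewrite /= -map_comp -[RHS]map_id; apply/eq_in_map => x xs.
  by rewrite /= inordK // ltnS le_s.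
by exists (map_tuple (fun x => inord x : 'I_n.+1) s); rewrite ?inE E.
Qed.

(* Main.v *)
(** Extend a preference sequence [t] to a map [f] of the cyclic group Z/(n+1) to
    itself, the element 0 serving as a dummy car with arbitrary preference: as
    in Pollak's argument, [t] is a parking function iff the other [n] cars, each
    driving round the circle to the first free spot, leave spot 0 empty.
    With q = 1 + y, the q-count of fixed points is the sum of y^|S| over the
    sets S of fixed points.  Fix a proper subset S and consider the maps that fix S
    pointwise.  Dropping the car p outside S, each of the (n+1)^(n+1-|S|) such
    maps leaves exactly one spot e empty, and e is outside S; how many of them
    leave e empty does not depend on p, by transposing p with another car
    outside S.  Hence one may take p = e, and by rotation e = 0.  Summing over S
    yields (n+1)^2 sum_t q^fix(t) = (y + n + 1)^(n+1) - y^(n+1). *)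
Require Import Defs.
From mathcomp Require Import all_boot all_order all_fingroup all_algebra.
From mathcomp Require Import zify.
Set Implicit Arguments.
Unset Strict Implicit.
Unset Printing Implicit Defensive.
Import GRing.Theory.
Local Open Scope ring_scope.

(** * Parking on the circle: the empty spot exists and is unique *)

Lemma val_subZp (n : nat) (x e : 'I_n.+1) :
  nat_of_ord (x - e) = (if e <= x then x - e else x + n.+1 - e)%N.
Proof.
have xn := ltn_ord x; have en := ltn_ord e.
rewrite /= modnDmr; case: leqP => ex.
  by rewrite addnBA 1?ltnW // addnC -addnBA // modnDl modn_small //; lia.
by rewrite addnBA 1?ltnW // modn_small //; lia.
Qed.

(** Subtraction is cyclic, so these are the cars preferring one of the [r] spots that follow [e]. If
    [e] stays empty, no car passes it, so only these cars can fill those spots. *)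
Definition arc_count (n : nat) (f : {ffun 'I_n.+1 -> 'I_n.+1}) (p e : 'I_n.+1)
    (r : nat) : nat :=
  #|[set i | (i != p) && (0 < (f i - e)%R <= r)%N]|.

(* The cars other than [p], with preferences [f] on a circle of [n.+1] spots,
   park so that exactly the spot [e] stays empty. *)
Definition parks_off (n : nat) (f : {ffun 'I_n.+1 -> 'I_n.+1}) (p e : 'I_n.+1)
    : bool :=
  [forall r : 'I_n.+1, (r <= arc_count f p e r)%N].

Lemma card_neq (n : nat) (p : 'I_n.+1) : #|[set i | i != p]| = n.
Proof. by rewrite cardsE cardC1 card_ord. Qed.

Lemma parks_off_neq (n : nat) (f : {ffun 'I_n.+1 -> 'I_n.+1}) p e i :
  parks_off f p e -> i != p -> f i != e.
Proof.
move=> /forallP/(_ ord_max) /= len ip; apply: contraL len => /eqP fie.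
rewrite -ltnNge -[X in (_ < X)%N](card_neq p); apply: proper_card.
apply/properP; split; first by apply/subsetP => j; rewrite !inE => /andP[].
by exists i; rewrite !inE ?ip // fie subrr.
Qed.

(* The arcs from [e] to [e'] and from [e'] to [e] would together hold at least
   [n.+1] cars. *)
Lemma parks_off_unique (n : nat) (f : {ffun 'I_n.+1 -> 'I_n.+1}) p e e' :
  parks_off f p e -> parks_off f p e' -> e = e'.
Proof.
move=> /forallP/(_ (e' - e)) le1 /forallP/(_ (e - e')) le2; apply/eqP.
move: le1 le2; rewrite /arc_count.
set A := [set i | _]; set B := [set i | _] => le1 le2.
case: eqVneq => // ne.
have dAB : A :&: B = set0.
  apply/setP => i; rewrite !inE !val_subZp.
  apply/negP; case: (leqP e e'); case: (leqP e' e);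
    case: (leqP e (f i)); case: (leqP e' (f i)); case: (i != p) => //=;
    move: ne; rewrite -val_eqE /=;
    have := ltn_ord (f i); have := ltn_ord e; have := ltn_ord e'; lia.
have := subset_leq_card (_ : A :|: B \subset [set i | i != p]).
rewrite card_neq cardsU dAB cards0 subn0 => le3.
have /(leq_trans (leq_add le1 le2)) : (#|A| + #|B| <= n)%N.
  by apply: le3; apply/subsetP => j; rewrite !inE => /orP[]/andP[].
move: ne; rewrite !val_subZp -val_eqE /=; have := ltn_ord e; have := ltn_ord e'.
by case: (leqP e e'); case: (leqP e' e); lia.
Qed.

(* [e] is the first minimum of [#{i != p | f i <= j} - j]. *)
Lemma parks_off_exists (n : nat) (f : {ffun 'I_n.+1 -> 'I_n.+1}) p :
  exists e, parks_off f p e.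
Proof.
pose L j := [set i | (i != p) && (f i <= j)%N].
(* Lexicographic key: [#|L j| - j] first, then [j]. Adding [n] keeps the truncated subtraction
   exact, and the factor [n.+1] leaves room for the tie-break. *)
pose h (j : 'I_n.+1) := ((#|L j| + n - j) * n.+1 + j)%N.
case: (@arg_minnP _ ord0 predT h) => // e _ emin.
have leL j : (#|L j| <= n)%N.
  rewrite -[X in (_ <= X)%N](card_neq p) subset_leq_card //.
  by apply/subsetP => i; rewrite !inE => /andP[].
have eLn := ltn_ord e.
have min1 (j : 'I_n.+1) : (#|L e| + j <= #|L j| + e)%N.
  have := emin j isT; rewrite /h; have := ltn_ord j; nia.
have min2 (j : 'I_n.+1) : (j < e)%N -> (#|L e| + j < #|L j| + e)%N.
  have := emin j isT; rewrite /h; have := ltn_ord j; nia.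
exists e; apply/forallP => r; rewrite /arc_count; have rn := ltn_ord r.
case: (leqP (e + r) n) => ern.
  pose j := Ordinal (ern : e + r < n.+1)%N.
  have -> : [set i | (i != p) && (0 < (f i - e)%R <= r)%N] = L j :\: L e.
    apply/setP => i; rewrite !inE val_subZp; have := ltn_ord (f i).
    by case: (i != p) => //=; case: (leqP e (f i)); lia.
  rewrite cardsD (setIidPr _); last first.
    by apply/subsetP => i; rewrite !inE /=; case: (i != p) => //=; lia.
  by have := min1 j; rewrite /=; lia.
(* The arc wraps past [n] and ends at [j < e]. The wrap costs one unit, which the strict inequality
   [min2] at a first minimum supplies. *)
have jP : (e + r - n.+1 < n.+1)%N by lia.
pose j := Ordinal jP.
have -> : [set i | (i != p) && (0 < (f i - e)%R <= r)%N]
    = L j :|: ([set i | i != p] :\: L e).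
  apply/setP => i; rewrite !inE val_subZp; have := ltn_ord (f i).
  by case: (i != p) => //=; case: (leqP e (f i)); lia.
rewrite cardsU (_ : L j :&: _ = set0) ?cards0 ?subn0; last first.
  by apply/setP => i; rewrite !inE /=; case: (i != p) => //=; lia.
rewrite cardsD card_neq (setIidPr _); last first.
  by apply/subsetP => i; rewrite !inE => /andP[].
by have := min2 j; have := leL e; rewrite /=; lia.
Qed.

Lemma parks_off_perm (n : nat) (f : {ffun 'I_n.+1 -> 'I_n.+1}) p e
    (s : {perm 'I_n.+1}) :
  parks_off [ffun i => f (s i)] p e = parks_off f (s p) e.
Proof.
apply: eq_forallb => r; congr (_ <= _)%N.
rewrite /arc_count -[RHS](card_preimset _ (@perm_inj _ s)).
by apply: eq_card => i; rewrite !inE ffunE (inj_eq perm_inj).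
Qed.

Lemma parks_off_rot (n : nat) (f : {ffun 'I_n.+1 -> 'I_n.+1}) p e c :
  parks_off [ffun i => f (i - c) + c] (p + c) (e + c) = parks_off f p e.
Proof.
apply: eq_forallb => r; congr (_ <= _)%N.
rewrite /arc_count -(card_preimset _ (addIr c)).
apply: eq_card => i; rewrite !inE ffunE (inj_eq (addIr c)) addrK.
by rewrite opprD addrACA subrr addr0.
Qed.

(** * Counting the maps that fix a given set pointwise *)

Definition fixes_on (n : nat) (S : {set 'I_n.+1})
    (f : {ffun 'I_n.+1 -> 'I_n.+1}) : bool :=
  [forall i in S, f i == i].

Lemma card_fixes_on (n : nat) (S : {set 'I_n.+1}) :
  #|[set f | fixes_on S f]| = (n.+1 ^ (n.+1 - #|S|))%N.
Proof.
pose F (i : 'I_n.+1) : pred 'I_n.+1 := if i \in S then pred1 i else predT.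
transitivity (\prod_(i : 'I_n.+1) #|F i|)%N.
  rewrite -big_enum -(big_map (fun i => #|F i|) predT id) -foldrE cardsE.
  apply: etrans (card_family F); apply: eq_card => f; rewrite unfold_in.
  apply/forallP/familyP => fS i; have := fS i; rewrite /F;
    by case: (i \in S).
rewrite (bigID (mem S)) /= big1 => [|i iS]; last by rewrite /F iS card1.
rewrite mul1n (eq_bigr (fun=> n.+1)) => [|i /negPf iS]; last first.
  by rewrite /F iS cardT size_enum_ord.
rewrite prod_nat_const; congr (_ ^ _)%N.
by rewrite -[LHS](addKn #|S|) cardC card_ord.
Qed.

(* Swapping the cars [p] and [e], neither of which lies in [S], makes the count
   independent of the omitted car. *)
Lemma card_fixes_parks (n : nat) (S : {set 'I_n.+1}) p e :
  p \notin S -> e \notin S ->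
  #|[set f | fixes_on S f && parks_off f p e]|
    = #|[set f | fixes_on S f && parks_off f e e]|.
Proof.
move=> pS eS.
pose g (f : {ffun 'I_n.+1 -> 'I_n.+1}) := [ffun i => f (tperm p e i)].
have gK : involutive g by move=> f; apply/ffunP => i; rewrite !ffunE tpermK.
rewrite -[RHS](card_preimset _ (inv_inj gK)); apply: eq_card => f.
rewrite !inE parks_off_perm tpermR; congr (_ && _).
apply: eq_forallb => i; case: (boolP (i \in S)) => //= iS.
rewrite ffunE tpermD //.
  by apply: contraNneq pS => ->.
by apply: contraNneq eS => ->.
Qed.

Lemma sum_card_fixes_parks (n : nat) (S : {set 'I_n.+1}) : S != setT ->
  (\sum_(e | e \notin S) #|[set f | fixes_on S f && parks_off f e e]|
    = n.+1 ^ (n.+1 - #|S|))%N.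
Proof.
rewrite -subTset => /subsetPn[p _ pS]; rewrite -card_fixes_on.
(* With one omitted car [p] for all [e], each map is counted once, at its unique empty spot. *)
under eq_bigr => e eS do rewrite -(card_fixes_parks pS eS) -sum1dep_card.
rewrite -sum1dep_card; under eq_bigr => e _ do rewrite big_mkcondr.
rewrite exchange_big /=; apply: eq_bigr => f fS; rewrite -big_mkcondr /=.
have [e pe] := parks_off_exists f p.
rewrite (big_pred1 e) // => e'; apply/andP/eqP => [[_ pe']| ->].
  exact: parks_off_unique pe' pe.
(* A car [e] in [S] is not [p] and prefers its own spot, so [e] cannot stay empty. *)
split=> //; apply: contraL pe => eS.
have ep : e != p by apply: contraNneq pS => <-.
have /forallP/(_ e) := fS; rewrite eS /= => /eqP fe.
by apply/negP => /parks_off_neq/(_ ep); rewrite fe eqxx.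
Qed.

(** * Subset expansions and summation over sets of fixed points *)

Lemma expr1D_subsets (R : comPzRingType) (T : finType) (F : {set T}) (y : R) :
  (1 + y) ^+ #|F| = \sum_(S : {set T} | S \subset F) y ^+ #|S|.
Proof.
pose G i : R := if i \in F then y else 0.
have -> : (1 + y) ^+ #|F| = \prod_i (G i + 1).
  rewrite (bigID (mem F)) /= [X in _ * X]big1 => [|i /negPf iF]; last first.
    by rewrite /G iF add0r.
  rewrite mulr1 -prodr_const; apply: eq_bigr => i iF.
  by rewrite /G iF addrC.
rewrite bigA_distr [RHS]big_mkcond /=; apply: eq_bigr => S _.
rewrite -big_mkcond /=; case: ifPn => [sSF | /subsetPn[i iS /negPf iF]].
  by rewrite -prodr_const; apply: eq_bigr => i /(subsetP sSF) iF; rewrite /G iF.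
by rewrite (bigD1 i) //= /G iF mul0r.
Qed.

Lemma exprD_subsets (R : comPzRingType) (T : finType) (a b : R) :
  (a + b) ^+ #|T| = \sum_(S : {set T}) a ^+ #|S| * b ^+ (#|T| - #|S|).
Proof.
rewrite -cardsT -prodr_const; under eq_bigl do rewrite inE.
rewrite bigA_distr; apply: eq_bigr => S _.
rewrite (bigID (mem S)) /= -[in RHS]prodr_const; congr (_ * _).
  by apply: eq_bigr => i ->.
rewrite (eq_bigr (fun=> b)) => [|i /negPf -> //].
by rewrite cardsT -(cardC S) addKn prodr_const.
Qed.

(** The dummy car [e] is excluded: it stands for no entry of the sequence. *)
Definition fixset_off (n : nat) (e : 'I_n.+1)
    (f : {ffun 'I_n.+1 -> 'I_n.+1}) : {set 'I_n.+1} :=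
  [set i | (i != e) && (f i == i)].

(** Conjugation by the rotation by [e] moves the empty spot and the dummy car from 0 to [e] and
    carries fixed points to fixed points. *)
Lemma sum_parks_rot (R : comPzRingType) (n : nat) (q : R) (e : 'I_n.+1) :
  \sum_(f | parks_off f e e) q ^+ #|fixset_off e f|
    = \sum_(f : {ffun 'I_n.+1 -> 'I_n.+1} | parks_off f 0 0)
        q ^+ #|fixset_off 0 f|.
Proof.
pose g (f : {ffun 'I_n.+1 -> 'I_n.+1}) := [ffun i => f (i - e) + e].
pose g' (f : {ffun 'I_n.+1 -> 'I_n.+1}) := [ffun i => f (i + e) - e].
have gK : cancel g g' by move=> f; apply/ffunP => i; rewrite !ffunE !addrK.
have gK' : cancel g' g by move=> f; apply/ffunP => i; rewrite !ffunE !subrK.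
rewrite (reindex g) /=; last by exists g' => f _.
apply: eq_big => [f | f _]; first by rewrite -[in LHS](add0r e) parks_off_rot.
congr (q ^+ _); rewrite -(card_preimset _ (addIr e)).
apply: eq_card => i; rewrite !inE ffunE addrK (inj_eq (addIr e)).
by rewrite -[X in _ != X]add0r (inj_eq (addIr e)).
Qed.

Lemma sum_parks_circle (R : comPzRingType) (n : nat) (y : R) :
  n.+1%:R * \sum_(f : {ffun 'I_n.+1 -> 'I_n.+1} | parks_off f 0 0)
              (1 + y) ^+ #|fixset_off 0 f|
    = (y + n.+1%:R) ^+ n.+1 - y ^+ n.+1.
Proof.
rewrite mulr_natl -[X in _ *+ X]card_ord -sumr_const.
under eq_bigr => e _.
  rewrite -(sum_parks_rot _ e).
  under eq_bigr => f _ do rewrite expr1D_subsets big_mkcond.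
  rewrite exchange_big /=; over.
(* The set [setT] is split off: on the right its term cancels [y ^+ n.+1], on the left it gives 0,
   as [fixset_off e f] never contains [e]. *)
rewrite exchange_big /= -[n.+1 in RHS]card_ord exprD_subsets (bigD1 setT) //=.
rewrite [in RHS](bigD1 setT) //= cardsT subnn expr0 mulr1 addrAC subrr add0r.
rewrite big1 ?add0r => [|e _]; last first.
  rewrite big1 // => f _; case: ifP => // /subsetP/(_ e).
  by rewrite !inE eqxx => /(_ isT).
apply: eq_bigr => S ST; rewrite !card_ord.
rewrite -natrX -(sum_card_fixes_parks ST) natr_sum mulr_sumr.
rewrite [RHS]big_mkcond /=; apply: eq_bigr => e _.
have subE f : (S \subset fixset_off e f) = (e \notin S) && fixes_on S f.
  apply/subsetP/andP => [sub | [eS /forallP fS] i iS]; last first.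
    rewrite inE; have /implyP/(_ iS) -> := fS i; rewrite andbT.
    by apply: contraNneq eS => <-.
  split; first by apply/negP => /sub; rewrite !inE eqxx.
  by apply/forallP => i; apply/implyP => /sub; rewrite inE => /andP[].
under eq_bigr do rewrite subE.
case: (boolP (e \in S)) => eS /=; first by rewrite big1.
rewrite -big_mkcondr /= sumr_const -cardsE mulr_natr; congr (_ *+ _).
by apply: eq_card => f; rewrite !inE andbC.
Qed.

(** * From maps of the circle back to parking functions *)

Lemma nth_sort_leqE (s : seq nat) (i m : nat) : (i < size s)%N ->
  (nth 0%N (sort leq s) i <= m)%N = (i < count (fun x => x <= m)%N s)%N.
Proof.
move=> si; rewrite -(count_sort leq); have st := sort_sorted leq_total s.
rewrite -(size_sort leq) in si; set u := sort leq s in st si *.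
have mono j k : (j <= k)%N -> (k < size u)%N -> (nth 0 u j <= nth 0 u k)%N.
  move=> jk ku; apply: (sorted_leq_nth leq_trans leqnn) => //.
  by rewrite inE (leq_ltn_trans jk).
(* The entries at most [m] form a prefix of [u]: it either covers positions 0 to [i] or stops before
   [i]. *)
rewrite -(cat_take_drop i.+1 u) count_cat.
case: (leqP (nth 0%N (take i.+1 u ++ drop i.+1 u) i) m);
  rewrite cat_take_drop => le.
  rewrite (_ : count _ (take _ _) = i.+1) ?leq_addr //.
  apply/eqP; rewrite -{2}(size_takel si) -all_count; apply/(all_nthP 0%N) => j.
  by rewrite size_takel // => ji; rewrite nth_take // (leq_trans _ le) ?mono.
rewrite -count_cat cat_take_drop -(cat_take_drop i u) count_cat.
rewrite (_ : count _ (drop _ _) = 0%N).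
  rewrite addn0; apply/esym/negbTE; rewrite -leqNgt.
  by rewrite -[X in (_ <= X)%N](size_takel (ltnW si)) count_size.
apply/eqP; rewrite -leqn0 leqNgt -has_count; apply/(has_nthP 0%N) => -[j].
rewrite size_drop nth_drop => ji; apply/negP; rewrite -ltnNge.
by rewrite (leq_trans le) // mono ?leq_addr //; lia.
Qed.

(** The dummy car takes index 0, so [lift ord0] shifts the 0-based positions of [t] to the
    mathematical ones. *)
Definition cons_word (n : nat) (a : 'I_n.+1) (t : n.-tuple 'I_n.+1)
    : {ffun 'I_n.+1 -> 'I_n.+1} :=
  [ffun i => oapp (tnth t) a (unlift ord0 i)].

Lemma cons_word_bij (n : nat) :
  bijective (fun u : 'I_n.+1 * n.-tuple 'I_n.+1 => cons_word u.1 u.2).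
Proof.
exists (fun f : {ffun 'I_n.+1 -> 'I_n.+1} => (f ord0,
  [tuple f (lift ord0 i) | i < n])) => [[a t] | f].
  rewrite /cons_word ffunE unlift_none /=; congr (_, _).
  by apply: eq_from_tnth => i; rewrite tnth_mktuple ffunE liftK.
apply/ffunP => i; rewrite ffunE /=.
by case: unliftP => [j|] -> //=; rewrite tnth_mktuple.
Qed.

Lemma card_lift0 (n : nat) (P : pred 'I_n.+1) :
  #|[set i | (i != 0) && P i]| = #|[set i : 'I_n | P (lift ord0 i)]|.
Proof.
rewrite -!sum1dep_card big_mkcond big_ord_recl /= add0n [RHS]big_mkcond.
by apply: eq_bigr => i _.
Qed.

(** The condition at [r = n] forces positive entries; given this, the one at [r = i.+1] is the bound
    on the sorted entry [i], restated as a count. *)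
Lemma parks_off_cons (n : nat) (a : 'I_n.+1) (t : n.-tuple 'I_n.+1) :
  parks_off (cons_word a t) 0 0 = (t \in PF n).
Proof.
have arcE r : arc_count (cons_word a t) 0 0 r
    = #|[set i | (0 < tnth t i <= r)%N]|.
  rewrite /arc_count (card_lift0 (fun i => 0 < (cons_word a t i - 0)%R <= r)%N).
  by apply: eq_card => i; rewrite !inE subr0 ffunE liftK.
have cntE r : count (fun x => x <= r)%N (nat_tuple t)
    = #|[set i | (tnth t i <= r)%N]|.
  by rewrite -sum1_count /= big_map big_tuple sum1dep_card.
have ntE i : tnth (nat_tuple t) i = tnth t i by rewrite tnth_map.
rewrite inE; apply/forallP/andP => [park | [/forallP pos /forallP srt] r].
  have pos i : (0 < tnth t i)%N.
    have := park ord_max; rewrite arcE /= => le.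
    have /eqP/setP/(_ i) : [set i | (0 < tnth t i <= n)%N] == setT.
      by rewrite eqEcard subsetT cardsT card_ord.
    by rewrite !inE => /andP[].
  split; apply/forallP => i; first by rewrite ntE.
  rewrite (tnth_nth 0%N) /= nth_sort_leqE ?size_tuple // cntE.
  have := park (lift ord0 i); rewrite arcE => /leq_trans; apply.
  by rewrite subset_leq_card //; apply/subsetP => j; rewrite !inE pos.
rewrite arcE; case: r => -[|r] // rn /=.
have := srt (Ordinal (rn : r < n)%N); rewrite (tnth_nth 0%N) /=.
rewrite nth_sort_leqE ?size_tuple // cntE => /leq_trans; apply.
by rewrite subset_leq_card //; apply/subsetP => j; rewrite !inE -ntE pos.
Qed.

Lemma fixset_off_cons (n : nat) (a : 'I_n.+1) (t : n.-tuple 'I_n.+1) :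
  #|fixset_off 0 (cons_word a t)| = num_fixed (nat_tuple t).
Proof.
rewrite /fixset_off (card_lift0 (fun i => cons_word a t i == i)).
by apply: eq_card => i; rewrite !inE ffunE liftK tnth_map -val_eqE.
Qed.

(** The factor [n.+1] counts the free preference [a] of the dummy car. *)
Lemma sum_PF_circle (R : comPzRingType) (n : nat) (q : R) :
  \sum_(f : {ffun 'I_n.+1 -> 'I_n.+1} | parks_off f 0 0)
      q ^+ #|fixset_off 0 f|
    = n.+1%:R * \sum_(t in PF n) q ^+ num_fixed (nat_tuple t).
Proof.
rewrite (reindex _ (onW_bij _ (cons_word_bij n))) /=.
under eq_bigl do rewrite parks_off_cons.
under eq_bigr do rewrite fixset_off_cons.
rewrite -(pair_big predT (mem (PF n))
  (fun _ t => q ^+ num_fixed (nat_tuple t))) /=.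
by rewrite sumr_const card_ord mulr_natl.
Qed.

Theorem theorem2p2 (n : nat) (hn : (1 <= n)%N) :
  \sum_(t in PF n) 'X^(num_fixed (nat_tuple t)) =
    (1 / (n%:R + 1) ^+ 2) *:
      (('X + n%:R) ^+ n.+1 - ('X - 1) ^+ n.+1) :> {poly rat}.
Proof.
(* For [y = 'X - 1], [1 + y] is ['X] and [y + n.+1%:R] is ['X + n%:R]. *)
have := sum_parks_circle n ('X - 1 : {poly rat}).
rewrite addrCA subrr addr0 sum_PF_circle -!natr1 addrACA addNr addr0.
rewrite mulrA -expr2 => <-.
have -> : n%:R + 1 = (n%:R + 1)%:P :> {poly rat}.
  by rewrite rmorphD /= polyC_natr.
rewrite -rmorphXn mul_polyC scalerA div1r mulVf ?scale1r //.
by rewrite expf_neq0 // natr1 Num.Theory.pnatr_eq0.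
Qed.
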